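(* Let $(G,i)$ be a filter pair over $\Sigma$, $X$ a set and $l=(\Sigma,\vdash^X)$ the associated logic with set of variables $X$. Then for any $\Sigma$-structure $A$, the subsets of $A$ in the image of $i_A$ are $l$-filters.
   Context: $\Sigma$-Str is the category of $\Sigma$-structures and homomorphisms; $Fm(X)$ is the absolutely free $\Sigma$-structure on $X$. $AL$ is the category of algebraic lattices with maps preserving arbitrary meets and directed joins. A filter pair over $\Sigma$ is a pair $(G,i)$ of a contravariant functor $G:\Sigma\text{-Str}\to AL$ and maps $i_A:G(A)\to(\mathcal{P}(A),\subseteq)$, one for each $\Sigma$-structure $A$, preserving arbitrary infima (in particular $i_A(\top)=A$) and directed suprema, such that $i_A\circ G(h)=h^{-1}\circ i_B$ for every homomorphism $h:A\to B$. The associated logic $(\Sigma,\vdash^X)$: for $\Gamma\cup\{\varphi\}\subseteq Fm(X)$, $\Gamma\vdash^X\varphi$ iff for every $a\in G(Fm(X))$, $\Gamma\subseteq i_{Fm(X)}(a)$ implies $\varphi\in i_{Fm(X)}(a)$. An $l$-filter on $A$ is a subset $F\subseteq A$ such that whenever $\Gamma\vdash^X\varphi$ and $v:Fm(X)\to A$ is a homomorphism with $v[\Gamma]\subseteq F$, then $v(\varphi)\in F$. *)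

(* Defs.v *)
From mathcomp Require Import all_boot all_order.
From mathcomp Require Import boolp classical_sets.
Set Implicit Arguments.
Unset Strict Implicit.
Unset Printing Implicit Defensive.

Local Open Scope classical_set_scope.

Definition directed (d : Order.disp_t) (T : porderType d) (D : set T) : Prop :=
  D !=set0 /\
  forall x y, D x -> D y -> exists z, [/\ D z, (x <= z)%O & (y <= z)%O].

(* [infimums S] and [supremums S] are the sets of greatest lower bounds and
   least upper bounds of [S], hence have at most one element; [S] may be empty
   in [preserves_infs], so that the top element is preserved. *)
Definition preserves_infs (d d' : Order.disp_t) (T : porderType d)
    (T' : porderType d') (f : T -> T') : Prop :=
  forall (S : set T) (x : T), infimums S x -> infimums (f @` S) (f x).

Definition preserves_directed_sups (d d' : Order.disp_t) (T : porderType d)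
    (T' : porderType d') (f : T -> T') : Prop :=
  forall (D : set T) (x : T),
    directed D -> supremums D x -> supremums (f @` D) (f x).

Definition complete (d : Order.disp_t) (T : porderType d) : Prop :=
  forall S : set T, supremums S !=set0 /\ infimums S !=set0.

Definition compact_elt (d : Order.disp_t) (T : porderType d) (c : T) : Prop :=
  forall (D : set T) (s : T), directed D -> supremums D s -> (c <= s)%O ->
    exists2 x, D x & (c <= x)%O.

Definition algebraic (d : Order.disp_t) (T : porderType d) : Prop :=
  complete T /\
  forall x : T, exists2 K : set T, (forall c, K c -> compact_elt c) &
    supremums K x.

Record algLattice := AlgLattice {
  al_disp : Order.disp_t;
  al_sort :> porderType al_disp;
  al_algebraic : algebraic al_sort }.

Record al_hom (L M : algLattice) := AlHom {
  al_fun :> L -> M;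
  al_fun_infs : preserves_infs al_fun;
  al_fun_directed_sups : preserves_directed_sups al_fun }.

(* [Sigma n] is the set of [n]-ary connectives. *)
Definition signature := nat -> Type.

Record sigma_str (Sigma : signature) := SigmaStr {
  str_sort :> Type;
  str_op : forall n, Sigma n -> ('I_n -> str_sort) -> str_sort }.

Definition is_hom (Sigma : signature) (A B : sigma_str Sigma) (h : A -> B) :
    Prop :=
  forall n (c : Sigma n) (a : 'I_n -> A),
    h (str_op c a) = str_op c (fun i => h (a i)).

Record hom (Sigma : signature) (A B : sigma_str Sigma) := Hom {
  hom_fun :> A -> B;
  hom_is_hom : is_hom hom_fun }.

Lemma id_is_hom (Sigma : signature) (A : sigma_str Sigma) :
  is_hom (fun x : A => x).
Proof. by []. Qed.

Definition id_hom (Sigma : signature) (A : sigma_str Sigma) : hom A A :=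
  Hom (@id_is_hom Sigma A).

Lemma comp_is_hom (Sigma : signature) (A B C : sigma_str Sigma)
  (g : hom B C) (h : hom A B) : is_hom (fun x => g (h x)).
Proof. by move=> n c a; rewrite hom_is_hom hom_is_hom. Qed.

Definition comp_hom (Sigma : signature) (A B C : sigma_str Sigma)
    (g : hom B C) (h : hom A B) : hom A C :=
  Hom (comp_is_hom g h).

Inductive formula (Sigma : signature) (X : Type) : Type :=
| Var of X
| App n of Sigma n & ('I_n -> formula Sigma X).

Definition Fm (Sigma : signature) (X : Type) : sigma_str Sigma :=
  @SigmaStr Sigma (formula Sigma X) (@App Sigma X).

Record al_functor (Sigma : signature) := AlFunctor {
  fobj :> sigma_str Sigma -> algLattice;
  fmap : forall A B : sigma_str Sigma, hom A B -> al_hom (fobj B) (fobj A);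
  fmap_id : forall (A : sigma_str Sigma) (x : fobj A),
    fmap (id_hom A) x = x;
  fmap_comp : forall (A B C : sigma_str Sigma) (g : hom B C) (h : hom A B)
    (x : fobj C), fmap (comp_hom g h) x = fmap h (fmap g x) }.

(* [set A] carries its canonical order, which is inclusion. *)
Record filter_pair (Sigma : signature) := FilterPair {
  fp_G : al_functor Sigma;
  fp_i : forall A : sigma_str Sigma, fp_G A -> set A;
  fp_i_infs : forall A : sigma_str Sigma, preserves_infs (@fp_i A);
  fp_i_directed_sups : forall A : sigma_str Sigma,
    preserves_directed_sups (@fp_i A);
  fp_i_natural : forall (A B : sigma_str Sigma) (h : hom A B) (b : fp_G B),
    fp_i (fmap fp_G h b) = h @^-1` fp_i b }.

Definition assoc_logic (Sigma : signature) (P : filter_pair Sigma) (X : Type)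
    (Gamma : set (Fm Sigma X)) (phi : Fm Sigma X) : Prop :=
  forall a : fp_G P (Fm Sigma X), Gamma `<=` fp_i a -> fp_i a phi.

Definition l_filter (Sigma : signature) (X : Type)
    (l : set (Fm Sigma X) -> Fm Sigma X -> Prop) (A : sigma_str Sigma)
    (F : set A) : Prop :=
  forall (Gamma : set (Fm Sigma X)) (phi : Fm Sigma X) (v : hom (Fm Sigma X) A),
    l Gamma phi -> v @` Gamma `<=` F -> F (v phi).

(* Main.v *)
Require Import Defs.
From mathcomp Require Import all_boot all_order.
From mathcomp Require Import boolp classical_sets.
Local Open Scope classical_set_scope.

(** The logic is defined so that every set [fp_i a] on formulas is closed under it. A valuation [v]
    pulls a set in the image of [fp_i] on [A] back to one of these, so closure under a rule instance
    in [A] reduces to closure in [Fm Sigma X]. *)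

Theorem proposition2p10 (Sigma : signature) (P : filter_pair Sigma) (X : Type)
    (A : sigma_str Sigma) (F : set A) :
  range (@fp_i Sigma P A) F -> l_filter (@assoc_logic Sigma P X) F.
Proof.
move=> [b _ <-] Gamma phi v Gamma_phi vGamma.
(* By naturality the inverse image of [fp_i b] under [v] is in the image of
   [fp_i] on formulas, where the definition of the logic applies. *)
have := Gamma_phi (fmap (fp_G P) v b); rewrite fp_i_natural; apply=> psi Gpsi.
(* [Gamma] lies in the preimage of [fp_i b] under [v] exactly when its image under [v] lies in
   [fp_i b]. *)
by apply: vGamma; exists psi.
Qed.
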